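(* Let $(X,\tau)$ be a noncompact metrizable space, let $a\in X$, and let $d$ be any metric on $X$ compatible with $\tau$ (not assumed bounded). Then there is a countably infinite $\tau$-closed discrete set $D=\{x_n:n\in\mathbb N\}\subseteq X\setminus\{a\}$ such that, for every sequence $(\lambda_n)_{n\ge 1}$ of real numbers with $\lambda_n>0$ and $\lambda_n\to0$, there is a metric $p$ on $X$ satisfying: (i) $p\le d$ pointwise, and the topology $\tau_p$ induced by $p$ belongs to $\mathcal L^m_a(\tau)$ with $\tau_p\subsetneq\tau$; (ii) for each $x\in X$ with $x\ne a$, there is a neighborhood $U_x$ of $x$, open in both $\tau$ and $\tau_p$, such that $p(y,z)=d(y,z)$ for all $y,z\in U_x$; (iii) $p(a,x_n)\le\lambda_n$ for every $n$, so $x_n\to a$ in $\tau_p$; (iv) if $d$ is complete, then $p$ is complete. Moreover, the same holds for every countably infinite $\tau$-closed discrete set $D=\{x_n:n\in\mathbb N\}\subseteq X\setminus\{a\}$ fixed in advance: for every such $D$ and every sequence $\lambda_n>0$ with $\lambda_n\to0$ there is a metric $p$ on $X$ satisfying (i)--(iv).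
   Context: $X$ is a nonempty set and $\mathbb N=\{1,2,\ldots\}$. A metric is compatible with a topology if it induces it. A set is closed discrete if it is closed in the ambient space and has the discrete subspace topology. Enumerations $\{x_n:n\in\mathbb N\}$ of countably infinite closed discrete sets are without repetitions. For a metrizable topology $\tau$ on $X$ and $a\in X$, $\mathcal L^m_a(\tau)$ denotes the set of all metrizable topologies $\sigma$ on $X$ such that $\sigma\subseteq\tau$ and $\sigma|_{X\setminus\{a\}}=\tau|_{X\setminus\{a\}}$ (equality of the subspace topologies on $X\setminus\{a\}$). *)

(* Defs.v *)
From HB Require Import structures.
From mathcomp Require Import all_boot all_order all_algebra.
From mathcomp Require Import all_classical all_reals all_analysis.

Set Implicit Arguments.
Unset Strict Implicit.
Unset Printing Implicit Defensive.

Import Order.TTheory GRing.Theory Num.Theory.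
Import numFieldNormedType.Exports.

Local Open Scope classical_set_scope.
Local Open Scope ring_scope.

(* Several topologies and metrics on one set X are compared, so they are
   first-class values here; [topspace tau] and [mspace d] are aliases of X
   carrying the corresponding library structure. *)

Record topology (X : Type) := Topology {
  opens : set_system X;
  opens_setT : opens setT;
  opens_setI : setI_closed opens;
  opens_bigcup : forall (I : Type) (f : I -> set X),
    (forall i, opens (f i)) -> opens (\bigcup_i f i)
}.

Definition topspace (X : Type) (tau : topology X) : Type := X.

HB.instance Definition _ (X : Type) (tau : topology X) :=
  gen_eqMixin (topspace tau).
HB.instance Definition _ (X : Type) (tau : topology X) :=
  gen_choiceMixin (topspace tau).
HB.instance Definition _ (X : Type) (tau : topology X) :=
  isOpenTopological.Build (topspace tau)
    (opens_setT tau) (@opens_setI X tau) (@opens_bigcup X tau).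

Lemma open_topspace (X : Type) (tau : topology X) :
  (open : set_system (topspace tau)) = opens tau.
Proof. by []. Qed.

Record metric (R : realType) (X : Type) := Metric {
  dist :> X -> X -> R;
  dist_xx : forall x, dist x x = 0;
  dist_eq0 : forall x y, dist x y = 0 -> x = y;
  dist_sym : forall x y, dist x y = dist y x;
  dist_triangle : forall y x z, dist x z <= dist x y + dist y z
}.

Definition mspace (R : realType) (X : Type) (d : metric R X) : Type := X.

HB.instance Definition _ (R : realType) (X : Type) (d : metric R X) :=
  gen_eqMixin (mspace d).
HB.instance Definition _ (R : realType) (X : Type) (d : metric R X) :=
  gen_choiceMixin (mspace d).
HB.instance Definition _ (R : realType) (X : Type) (d : metric R X) :=
  isMetric.Build R (mspace d)
    (dist_xx d) (@dist_eq0 R X d) (dist_sym d) (dist_triangle d).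

Definition metric_topology (R : realType) (X : Type) (d : metric R X) :
    topology X :=
  @Topology X (open : set_system (mspace d))
    openT (@openI (mspace d))
    (fun I f fo => @bigcup_open (mspace d) I setT f (fun i _ => fo i)).

Definition compatible (R : realType) (X : Type) (d : metric R X)
    (tau : topology X) : Prop :=
  opens (metric_topology d) = opens tau.

Definition metrizable (R : realType) (X : Type) (tau : topology X) : Prop :=
  exists d : metric R X, compatible d tau.

Definition complete_metric (R : realType) (X : Type) (d : metric R X) : Prop :=
  forall u : nat -> mspace d,
    cauchy (u @ \oo) -> exists l : mspace d, u @ \oo --> l.

Definition subspace_opens (X : Type) (tau : topology X) (A : set X) :
    set_system (set_type A) :=
  (open : set_system (set_type (A : set (topspace tau)))).
Arguments subspace_opens {X} tau A.

Definition closed_discrete (X : Type) (tau : topology X) (D : set X) : Prop :=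
  closed (D : set (topspace tau)) /\ subspace_opens tau D = [set: set (set_type D)].

Definition Lm (R : realType) (X : Type) (a : X) (tau : topology X) :
    set (topology X) :=
  [set sigma | [/\ metrizable R sigma, opens sigma `<=` opens tau &
    subspace_opens sigma (~` [set a]) = subspace_opens tau (~` [set a])]].

Definition collapsing_metric (R : realType) (X : Type) (tau : topology X)
    (a : X) (d : metric R X) (x : nat -> X) (lambda : nat -> R)
    (p : metric R X) : Prop :=
  [/\ [/\ forall y z, p y z <= d y z,
          Lm R a tau (metric_topology p) &
          opens (metric_topology p) `<` opens tau],
      forall y, y <> a -> exists U : set X,
        [/\ U y, opens tau U, opens (metric_topology p) U &
            forall z w, U z -> U w -> p z w = d z w],
      (forall n, p a (x n) <= lambda n) /\
      (x : nat -> topspace (metric_topology p)) @ \oo -->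
        (a : topspace (metric_topology p)) &
      complete_metric d -> complete_metric p].

(* Main.v *)
Require Import Defs.
From mathcomp Require Import all_boot all_order all_algebra.
From mathcomp Require Import all_classical all_reals all_analysis.
From mathcomp Require Import finmap lra.

Import Order.TTheory GRing.Theory Num.Theory.
Import numFieldNormedType.Exports.

Local Open Scope classical_set_scope.
Local Open Scope ring_scope.

(** Give every point [y] a cost [f y] of reaching [a], where [f] is 1-Lipschitz
    for [d] and vanishes only at [a], and let
      [p y z = min (d y z) (f y + f z)]:
    a journey goes either directly or through [a].  The Lipschitz condition is
    what makes [p] satisfy the triangle inequality.  Every [p] of this form
    agrees locally with [d] off [a]: if [y <> a] then [f y > 0], and within
    distance of order [f y] from [y] the detour through [a] never pays, so that
    [p = d] there ([collapse_ball], [collapse_dist_near]).  Hence the topology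
    is unchanged off [a].  Completeness is inherited ([complete_collapse]): a
    [p]-Cauchy sequence whose costs come arbitrarily close to 0 converges to
    [a], and any other one is eventually bounded away from [a], where small
    [p]-distances are [d]-distances.

    The points [x n] are pulled towards [a] by the choice
      [f y = inf (d y a, inf_n (d y (x n) + lambda n))],
    the cost of walking to [a] when there is also a road of length [lambda n]
    from [x n] to [a].  It gives [p a (x n) = f (x n) <= lambda n].  That [f]
    is positive off [a] is exactly where closed discreteness enters: a closed
    discrete set has no accumulation point ([closed_discreteP]), so all but at
    most one of the [x n] stay at a fixed distance from [y].  Since [x n]
    tends to [a] for [p] but not for [d], the new topology is strictly coarser.

    It remains to find an infinite closed discrete set in a noncompact space.
    Suppose that every infinite set accumulates somewhere.  Then the space is
    totally bounded ([finite_net]), so that an ultrafilter contains balls of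
    all radii [1 / n.+1], and a cluster point of their centers
    ([sequence_cluster]) is a limit of the ultrafilter: the space is
    compact. *)

(** * Metric descriptions of open sets, limits and completeness *)

Lemma distance_ge0 {R : realType} {X : Type} (d : metric R X) (x y : X) :
  0 <= d x y.
Proof.
have := dist_triangle d y x x; rewrite dist_xx (dist_sym d y x); lra.
Qed.

Lemma distance_gt0 {R : realType} {X : Type} (d : metric R X) [x y : X] :
  x <> y -> 0 < d x y.
Proof.
move=> xy; rewrite lt_neqAle distance_ge0 andbT eq_sym.
by apply/eqP => dxy; exact/xy/(dist_eq0 dxy).
Qed.

Lemma nbhs_mspaceP {R : realType} {X : Type} (d : metric R X) (y : mspace d)
    (V : set X) :
  nbhs y V <-> exists2 r, 0 < r & forall z, d y z < r -> V z.
Proof.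
split=> [/nbhs_ballP[r /= r0 rV]|[r r0 rV]].
  by exists r => // z yz; apply: rV; rewrite ballEmdist.
by apply/nbhs_ballP; exists r => //= z; rewrite ballEmdist; exact: rV.
Qed.

(** [topspace tau] and [mspace d] carry different neighbourhood structures, one
    generated by open sets and the other by balls; they agree because both are
    determined by the same open sets. *)
Lemma nbhs_topspaceP {R : realType} {X : Type} {d : metric R X}
    {tau : topology X} (d_tau : compatible d tau) (y : topspace tau)
    (V : set X) :
  nbhs y V <-> exists2 r, 0 < r & forall z, d y z < r -> V z.
Proof.
rewrite -nbhs_mspaceP !nbhsE /=.
by split=> -[U [oU Uy] UV]; exists U => //; split=> //; move: oU;
  rewrite !open_topspace /open_nbhs -?d_tau.
Qed.

Lemma opensP {R : realType} {X : Type} {d : metric R X}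
    {tau : topology X} (d_tau : compatible d tau) (U : set X) :
  opens tau U <->
  forall y, U y -> exists2 r, 0 < r & forall z, d y z < r -> U z.
Proof.
rewrite -open_topspace openE.
by split=> oU y Uy; exact/(nbhs_topspaceP d_tau)/oU.
Qed.

Lemma compatible_metric_topology {R : realType} {X : Type} (d : metric R X) :
  compatible d (metric_topology d).
Proof. by []. Qed.

Lemma cvg_mspaceP {R : realType} {X : Type} (d : metric R X)
    (u : nat -> X) (l : X) :
  (u : nat -> mspace d) @ \oo --> (l : mspace d) <->
  forall e, 0 < e -> exists N, forall n, (N <= n)%N -> d l (u n) < e.
Proof.
split=> [ul e e0|ul V /nbhs_mspaceP[r /ul[N ?] rV]].
  have /ul[N _ NV] : nbhs (l : mspace d) [set z | d l z < e].
    by apply/nbhs_mspaceP; exists e.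
  by exists N => n /NV.
by exists N => // n /= Nn; apply: rV; auto.
Qed.

Lemma cvg_topspaceP {R : realType} {X : Type} (d : metric R X)
    (u : nat -> X) (l : X) :
  (u : nat -> topspace (metric_topology d)) @ \oo -->
    (l : topspace (metric_topology d)) <->
  forall e, 0 < e -> exists N, forall n, (N <= n)%N -> d l (u n) < e.
Proof.
rewrite -cvg_mspaceP; split=> ul V.
- by move/nbhs_mspaceP/(nbhs_topspaceP (compatible_metric_topology d))/ul.
- by move/(nbhs_topspaceP (compatible_metric_topology d))/nbhs_mspaceP/ul.
Qed.

(** Asking the tails to lie in small balls, with arbitrary centers, avoids
    quantifying over two indices. *)
Lemma cauchy_mspaceP {R : realType} {X : Type} (d : metric R X)
    (u : nat -> mspace d) :
  cauchy (u @ \oo) <->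
  forall e, 0 < e -> exists c N, forall n, (N <= n)%N -> d c (u n) < e.
Proof.
rewrite cauchyP; split=> cu e e0.
  have [c [N _ Nc]] := cu e e0; exists c, N => n /Nc /=.
  by rewrite ballEmdist.
by have [c [N Nc]] := cu e e0; exists c; exists N.
Qed.

(** * Sets without accumulation points *)

Definition no_accumulation {R : realType} {X : Type} (d : metric R X)
    (S : set X) : Prop :=
  forall y, exists2 r, 0 < r & forall z, S z -> d y z < r -> z = y.

Lemma no_accumulationS {R : realType} {X : Type} (d : metric R X)
    [S T : set X] : S `<=` T -> no_accumulation d T -> no_accumulation d S.
Proof.
by move=> ST nT y; have [r r0 rT] := nT y; exists r => // z /ST; exact: rT.
Qed.

Lemma opens_setC_no_accumulation {R : realType} {X : Type} {d : metric R X}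
    {tau : topology X} (d_tau : compatible d tau) [S : set X] :
  no_accumulation d S -> opens tau (~` S).
Proof.
move=> nS; apply/(opensP d_tau) => y Sy; have [r r0 rS] := nS y.
by exists r => // z yz Sz; apply: Sy; rewrite -(rS z).
Qed.

(** In a Hausdorff space finite sets are closed. *)
Lemma finite_dist_gt0 {R : realType} {X : Type} (d : metric R X)
    [A : set X] [y : X] : finite_set A -> ~ A y ->
  exists2 r, 0 < r & forall z, d y z < r -> ~ A z.
Proof.
move=> finA Ay.
have /accessible_finite_set_closed finite_closed : accessible_space (mspace d).
  exact/hausdorff_accessible/metric_hausdorff.
have cA : closed (A : set (mspace d)) by exact: finite_closed.
apply/(nbhs_mspaceP d y (~` A)).
by apply: open_nbhs_nbhs; split=> //; rewrite openC.
Qed.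

Lemma no_accumulation_set1 {R : realType} {X : Type} (d : metric R X) (a : X) :
  no_accumulation d [set a].
Proof.
move=> y; have [->|ya] := pselect (y = a); first by exists 1.
have [r r0 ra] := finite_dist_gt0 d (finite_set1 a) ya.
by exists r => // z za /ra[].
Qed.

Lemma opens_setD1 {R : realType} {X : Type} {d : metric R X}
    {tau : topology X} (d_tau : compatible d tau) [U : set X] (a : X) :
  opens tau U -> opens tau (U `\ a).
Proof.
move=> oU; rewrite setDE; apply: opens_setI => //.
apply: (opens_setC_no_accumulation d_tau).
exact: no_accumulation_set1.
Qed.

Lemma opens_dist_ball {R : realType} {X : Type} {d : metric R X}
    {tau : topology X} (d_tau : compatible d tau) (y : X) (r : R) :
  opens tau [set z | d y z < r].
Proof.
apply/(opensP d_tau) => z /= yz; exists (r - d y z); first by rewrite subr_gt0.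
by move=> w zw; have := dist_triangle d z y w; lra.
Qed.

(** Every subset of a set without accumulation points is again such a set, hence
    closed; this makes every subset of [D] relatively open. *)
Lemma closed_discreteP {R : realType} {X : Type} {d : metric R X}
    {tau : topology X} (d_tau : compatible d tau) (D : set X) :
  closed_discrete tau D <-> no_accumulation d D.
Proof.
split=> [[cD dD] y|nD].
  have [Dy|Dy] := pselect (D y); last first.
    have oD : opens tau (~` D) by rewrite -open_topspace openC.
    have [r r0 rD] := (opensP d_tau _).1 oD y Dy.
    by exists r => // z Dz /rD.
  have : subspace_opens tau D [set SigSub (mem_set Dy)] by rewrite dD.
  case=> V oV VD.
  have Vy : (set_val @^-1` V) (SigSub (mem_set Dy)) by rewrite VD.
  have [r r0 rV] := (opensP d_tau _).1 oV y Vy.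
  exists r => // z Dz /rV Vz.
  have : (set_val @^-1` V) (SigSub (mem_set Dz)) by exact: Vz.
  by rewrite VD => /(congr1 set_val).
split.
  by rewrite -openC open_topspace; exact: opens_setC_no_accumulation nD.
apply/seteqP; split=> // W _.
(* [W] is the trace on [D] of the complement of the closed set [D `\` W]. *)
exists (~` (D `\` set_val @` W)).
  apply: (opens_setC_no_accumulation d_tau); apply: no_accumulationS nD.
  by move=> ? [].
apply/seteqP; split=> z /=.
  move=> Wz; apply: contrapT => nWz; apply: Wz; split.
    exact/set_mem/(valP z).
  by case=> w Ww /val_inj wz; apply: nWz; rewrite -wz.
by move=> Wz [_]; apply; exists z.
Qed.

(** * The collapsed metric *)

(** The cost of reaching [a]; the Lipschitz condition at [a] bounds it by the
    distance to [a]. *)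
Record gauge {R : realType} {X : Type} (d : metric R X) (a : X) := Gauge {
  gauge_fun :> X -> R;
  gauge_lipschitz : forall y z, gauge_fun y <= d y z + gauge_fun z;
  gauge_base : gauge_fun a = 0;
  gauge_gt0 : forall y, y <> a -> 0 < gauge_fun y
}.
Arguments gauge_lipschitz {R X d a}.
Arguments gauge_base {R X d a}.
Arguments gauge_gt0 {R X d a}.

Section Collapse.
Context {R : realType} {X : Type} {d : metric R X} {a : X} (f : gauge d a).

Lemma gauge_ge0 y : 0 <= f y.
Proof.
have [->|/(gauge_gt0 f)/ltW//] := pselect (y = a).
by rewrite gauge_base.
Qed.

Definition collapse_dist (y z : X) : R := Num.min (d y z) (f y + f z).

Lemma collapse_dist_le y z : collapse_dist y z <= d y z.
Proof. by rewrite ge_min lexx. Qed.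

(** The detour from [y] costs at least [f y], so anything cheaper is direct. *)
Lemma collapse_dist_near y z :
  collapse_dist y z < f y -> collapse_dist y z = d y z.
Proof.
rewrite /collapse_dist; have := gauge_ge0 z.
by case: (leP (d y z) (f y + f z)) => // _; lra.
Qed.

Lemma collapse_dist_xx y : collapse_dist y y = 0.
Proof.
by rewrite /collapse_dist dist_xx min_l// addr_ge0// gauge_ge0.
Qed.

Lemma collapse_dist_eq0 y z : collapse_dist y z = 0 -> y = z.
Proof.
rewrite /collapse_dist; have := gauge_ge0 z; have := gauge_ge0 y.
case: (leP (d y z) (f y + f z)) => // _ fy fz; first exact: dist_eq0.
move=> fyz.
have null w : f w <= 0 -> w = a.
  by rewrite leNgt => /negP fw; apply: contrapT => /(gauge_gt0 f).
have fy0 : f y <= 0 by clear null; lra.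
have fz0 : f z <= 0 by clear null; lra.
by rewrite (null _ fy0) (null _ fz0).
Qed.

Lemma collapse_dist_sym y z : collapse_dist y z = collapse_dist z y.
Proof. by rewrite /collapse_dist dist_sym addrC. Qed.

(** If both legs are direct, the triangle inequality of [d] applies; if exactly
    one is a detour, the Lipschitz condition moves its cost from [z] to the
    other endpoint; if both are, then [f z] is paid twice for nothing. *)
Lemma collapse_dist_triangle z y w :
  collapse_dist y w <= collapse_dist y z + collapse_dist z w.
Proof.
rewrite /collapse_dist ge_min.
have := dist_triangle d z y w; have := gauge_lipschitz f y z.
have := gauge_lipschitz f w z; have := gauge_ge0 z.
rewrite (dist_sym d w z); set A := d y w; set B := d y z; set C := d z w.
case: (leP B (f y + f z)) => ?; case: (leP C (f z + f w)) => ? ? ? ? ?;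
  apply/orP; by [left; lra|right; lra].
Qed.

Definition collapse : metric R X :=
  @Defs.Metric R X _ collapse_dist_xx collapse_dist_eq0 collapse_dist_sym
    collapse_dist_triangle.

Lemma collapse_base y : collapse a y = f y.
Proof.
rewrite /= /collapse_dist (gauge_base f) add0r min_r// dist_sym.
by have := gauge_lipschitz f y a; rewrite gauge_base addr0.
Qed.

(** In the ball of radius [f y / 2] all costs exceed [f y / 2], so a detour
    costs at least [f y], which bounds the distances in the ball. *)
Lemma collapse_ball [y] : y <> a ->
  exists2 r, 0 < r & forall z w, d y z < r -> d y w < r ->
    collapse z w = d z w.
Proof.
move=> /(gauge_gt0 f) fy; exists (f y / 2); first lra.
move=> z w yz yw; apply: min_l.
have := gauge_lipschitz f y z; have := gauge_lipschitz f y w.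
have := dist_triangle d y z w; rewrite (dist_sym d z y); lra.
Qed.

Context {tau : topology X} (d_tau : compatible d tau).

Lemma collapse_opens_sub : opens (metric_topology collapse) `<=` opens tau.
Proof.
move=> U /(opensP (compatible_metric_topology _)) oU.
apply/(opensP d_tau) => y /oU[r r0 rU].
by exists r => // z yz; apply: rU; exact: le_lt_trans (collapse_dist_le _ _) yz.
Qed.

Lemma collapse_opens_off [U] : ~ U a ->
  opens tau U -> opens (metric_topology collapse) U.
Proof.
move=> Ua /(opensP d_tau) oU.
apply/(opensP (compatible_metric_topology _)) => y Uy.
have /(gauge_gt0 f) fy : y <> a by move=> ya; apply: Ua; rewrite -ya.
have [r r0 rU] := oU y Uy.
exists (Num.min r (f y)); first by rewrite lt_min r0.
move=> z; rewrite lt_min => /andP[yzr yzf]; apply: rU.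
by rewrite -collapse_dist_near.
Qed.

Lemma collapse_subspace_opens :
  subspace_opens (metric_topology collapse) (~` [set a]) =
  subspace_opens tau (~` [set a]).
Proof.
apply/seteqP; split=> W [V oV <-].
  by exists V => //; exact: collapse_opens_sub.
exists (V `\ a).
  apply: collapse_opens_off; first by case=> _; apply.
  exact: (opens_setD1 d_tau).
apply/seteqP; split=> z /=; first by case.
by split=> //; have := set_mem (valP z).
Qed.

(** A Cauchy sequence with costs coming arbitrarily close to 0 has [a] as a
    cluster point, hence as its limit.  Otherwise its costs are eventually at
    least some [r > 0], so that distances below [r] are those of [d]. *)
Lemma complete_collapse : complete_metric d -> complete_metric collapse.
Proof.
move=> cd u /cauchy_mspaceP cu.
have [near_a|] := pselect (forall r N, 0 < r ->
    exists2 n, (N <= n)%N & f (u n) < r).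
  exists a; apply/cvg_mspaceP => e e0.
  have [|c [N Nc]] := cu (e / 3); first lra.
  have [|m Nm fm] := near_a (e / 3) N; first lra.
  exists N => n Nn; have := Nc n Nn; have := Nc m Nm.
  have := dist_triangle collapse (u m) a (u n).
  have := dist_triangle collapse c (u m) (u n).
  by rewrite (dist_sym _ (u m) c) (collapse_base (u m)); lra.
move=> /existsNP[r /existsNP[N /not_implyP[r0 far]]].
have {}far n : (N <= n)%N -> r <= f (u n).
  by move=> Nn; rewrite leNgt; apply/negP => fn; apply: far; exists n.
have [l ul] : exists l : mspace d, (u : nat -> mspace d) @ \oo --> l.
  apply: cd; apply/cauchy_mspaceP => e e0.
  have [|c [M Mc]] := cu (Num.min e r / 2).
    by rewrite divr_gt0// lt_min e0.
  exists (u (maxn N M)), (maxn N M) => n; rewrite geq_max => /andP[Nn Mn].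
  have : collapse (u (maxn N M)) (u n) < Num.min e r.
    have := dist_triangle collapse c (u (maxn N M)) (u n).
    have := Mc _ Mn; have := Mc _ (leq_maxr N M).
    by rewrite (dist_sym _ _ c); lra.
  rewrite lt_min => /andP[ltnr ltnf]; rewrite -collapse_dist_near//.
  exact: lt_le_trans ltnf (far _ (leq_maxl _ _)).
exists l; apply/cvg_mspaceP => e e0.
have /cvg_mspaceP/(_ e e0)[M Ml] := ul.
by exists M => n /Ml; apply: le_lt_trans; exact: collapse_dist_le.
Qed.

End Collapse.

(** * The gauge of a family of shortcuts to the base point *)

Section Shortcut.
Context {R : realType} {X : Type} (d : metric R X) (a : X) (x : nat -> X).
Context (lambda : nat -> R).
Hypothesis lambda_gt0 : forall n, 0 < lambda n.
Hypothesis x_inj : injective x.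
Hypothesis x_discrete : no_accumulation d (range x).

Definition shortcut_costs (y : X) : set R :=
  d y a |` [set d y (x n) + lambda n | n in setT].

Definition shortcut (y : X) : R := inf (shortcut_costs y).

Lemma shortcut_le y r : shortcut_costs y r -> shortcut y <= r.
Proof.
apply: ge_inf; exists 0 => _ [->|[n _ <-]]; first exact: distance_ge0.
by rewrite addr_ge0 ?distance_ge0// ltW.
Qed.

Lemma le_shortcut y m : m <= d y a ->
  (forall n, m <= d y (x n) + lambda n) -> m <= shortcut y.
Proof.
move=> ma mx; apply: lb_le_inf; first by exists (d y a); left.
by move=> _ [->|[n _ <-]].
Qed.

Lemma shortcut_lipschitz y z : shortcut y <= d y z + shortcut z.
Proof.
rewrite -lerBlDl; apply: le_shortcut => [|n]; rewrite lerBlDl.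
  by apply: le_trans (dist_triangle d z y a); apply: shortcut_le; left.
rewrite addrA; apply: le_trans (lerD (dist_triangle d z y (x n)) (lexx _)).
by apply: shortcut_le; right; exists n.
Qed.

Lemma shortcut_base : shortcut a = 0.
Proof.
apply/eqP; rewrite eq_le; apply/andP; split.
  by apply: shortcut_le; left; rewrite dist_xx.
apply: le_shortcut => [|n]; first by rewrite dist_xx.
by rewrite addr_ge0 ?distance_ge0// ltW.
Qed.

(** A ball around [y] contains no [x n], except perhaps [y = x k] itself, for
    which the toll [lambda k] remains to be paid.  Thus a positive lower bound
    exists without any uniformity in [lambda]. *)
Lemma shortcut_gt0 y : y <> a -> 0 < shortcut y.
Proof.
move=> ya; have [r r0 rx] := x_discrete y.
have da := distance_gt0 d ya.
have [m m0 mx] : exists2 m, 0 < m & forall n, m <= d y (x n) + lambda n.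
  have far n : x n <> y -> r <= d y (x n) + lambda n.
    move=> ny; have : ~ d y (x n) < r by move=> /(rx (x n)); auto.
    by move/negP; rewrite -leNgt => ?; have := lambda_gt0 n; lra.
  have [[k xk]|nx] := pselect (exists k, x k = y).
    exists (Num.min r (lambda k)) => [|n].
      by rewrite lt_min r0 lambda_gt0.
    rewrite ge_min; have [xn|/far->//] := pselect (x n = y).
    have -> : n = k by apply: x_inj; rewrite xn xk.
    by apply/orP; right; have := distance_ge0 d y (x k); lra.
  by exists r => // n; apply: far => xn; apply: nx; exists n.
apply: (@lt_le_trans _ _ (Num.min (d y a) m)); first by rewrite lt_min da.
by apply: le_shortcut => [|n]; rewrite ge_min ?lexx// mx orbT.
Qed.

Definition shortcut_gauge : gauge d a :=
  @Gauge R X d a _ shortcut_lipschitz shortcut_base shortcut_gt0.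

Lemma shortcut_gauge_le n : shortcut_gauge (x n) <= lambda n.
Proof. by apply: shortcut_le; right; exists n => //; rewrite dist_xx add0r. Qed.

End Shortcut.
Arguments shortcut_gauge {R X d a x lambda}.
Arguments shortcut_gauge_le {R X d a x lambda}.

Lemma collapsing_metric_no_accumulation {R : realType} {X : Type}
    (tau : topology X) (a : X) (d : metric R X) (x : nat -> X)
    (lambda : nat -> R) :
  compatible d tau -> injective x -> no_accumulation d (range x) ->
  (forall n, x n <> a) -> (forall n, 0 < lambda n) ->
  lambda @ \oo --> (0 : R) ->
  exists p : metric R X, collapsing_metric tau a d x lambda p.
Proof.
move=> d_tau x_inj nx xa l0 lcvg.
pose f := shortcut_gauge (a := a) l0 x_inj nx.
pose p := collapse f.
have fx n : p a (x n) <= lambda n.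
  by rewrite collapse_base; exact: shortcut_gauge_le.
have pcvg e : 0 < e -> exists N, forall n, (N <= n)%N -> p a (x n) < e.
  move=> e0; have /cvgrPdist_lt/(_ e e0)[N _ Nl] := lcvg.
  exists N => n /Nl /=; rewrite sub0r normrN; apply: le_lt_trans.
  exact: le_trans (fx n) (ler_norm _).
have p_sub := collapse_opens_sub f d_tau.
exists p; split.
- split; first exact: collapse_dist_le.
    split=> //; first by exists p.
    exact: collapse_subspace_opens.
  split=> // /(_ _ (opens_setC_no_accumulation d_tau nx)).
  move=> /(opensP (compatible_metric_topology _))/(_ a)[].
    by case=> n _; exact: xa.
  move=> r /pcvg[N Np] rx; apply: (rx (x N)); first exact: Np.
  by exists N.
- move=> y ya; have [r r0 rp] := collapse_ball f ya.
  have oU : opens tau ([set z | d y z < r] `\ a).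
    by apply: (opens_setD1 d_tau); exact: opens_dist_ball.
  exists ([set z | d y z < r] `\ a); split=> //.
  + by split=> //=; rewrite dist_xx.
  + by apply: (collapse_opens_off f d_tau) => // -[_]; apply.
  + by move=> z w [yz _] [yw _]; exact: rp.
- by split=> //; apply/cvg_topspaceP.
- exact: complete_collapse.
Qed.

(** * Noncompact metrizable spaces contain infinite closed discrete sets *)

Lemma ultra_finite_bigcup {T : Type} {I : choiceType} (F : set_system T)
    (A : set I) (B : I -> set T) :
  UltraFilter F -> finite_set A -> F (\bigcup_(i in A) B i) ->
  exists2 i, A i & F (B i).
Proof.
move=> FU /finite_fsetP[E ->] FB; apply: contrapT => none.
have FnB : F (\bigcap_(i in [set` E]) ~` B i).
  apply: filter_bigI => i iE.
  by have [FBi|//] := in_ultra_setVsetC (B i) FU; case: none; exists i.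
apply: (@filter_not_empty _ F _).
apply: filterS (filterI FB FnB) => t [[i iE Bit]] /(_ i iE); exact.
Qed.

Section LimitPointCompact.
Context {R : realType} {X : Type} (d : metric R X).
(** Limit point compactness, from which compactness is derived. *)
Hypothesis limit_points : forall S, infinite_set S -> ~ no_accumulation d S.

(** Without a cluster point every value is taken finitely often, so the range is
    infinite; and it has no accumulation point, since only finitely many terms
    need to be avoided near any given point. *)
Lemma sequence_cluster (u : nat -> X) : exists y, forall r N, 0 < r ->
  exists2 n, (N <= n)%N & d y (u n) < r.
Proof.
apply: contrapT => /forallNP no_cluster.
have avoid y : exists r N, 0 < r /\ forall n, (N <= n)%N -> ~ d y (u n) < r.
  have /existsNP[r /existsNP[N /not_implyP[r0 far]]] := no_cluster y.
  by exists r, N; split=> // n Nn yn; apply: far; exists n.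
apply: (@limit_points (range u)) => [finu|y].
  apply: infinite_nat.
  have -> : [set: nat] = \bigcup_(y in range u) (u @^-1` [set y]).
    by apply/seteqP; split=> // n _; exists (u n).
  apply: bigcup_finite => // y _; have [r [N [r0 far]]] := avoid y.
  apply: (sub_finite_set _ (finite_II N)) => n /= un.
  rewrite ltnNge; apply/negP => /far; apply.
  by rewrite un dist_xx.
have [r [N [r0 far]]] := avoid y.
have [s s0 near_y] : exists2 s, 0 < s &
    forall z, d y z < s -> ~ (u @` `I_N `\ y) z.
  apply: finite_dist_gt0; last by case=> _; apply.
  exact/finite_setD/finite_image/finite_II.
exists (Num.min r s); first by rewrite lt_min r0.
move=> _ [n _ <-]; rewrite lt_min => /andP[ltr lts].
apply: contrapT => uny; apply: (near_y _ lts); split=> //.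
exists n => //=; rewrite ltnNge; apply/negP => /far; exact.
Qed.

(** A maximal [e]-separated set is an [e]-net, and it has no accumulation point
    since a ball of radius [e / 2] meets it at most once. *)
Lemma finite_net e : 0 < e ->
  exists2 A : set X, finite_set A & forall y, exists2 z, A z & d z y < e.
Proof.
move=> e0.
pose separated (A : set X) := forall y z, A y -> A z -> d y z < e -> y = z.
have [F FP Ftot|A [sepA maxA]] := @Zorn_bigcup X separated.
  move=> y z [B FB By] [C FC Cz].
  by have [BC|CB] := Ftot _ _ FB FC;
    [apply: (FP C) => //; exact: BC|apply: (FP B) => //; exact: CB].
(* The center [y] may lie outside [A], so the ball is shrunk to exclude the
   one point [w] of [A] that it may contain. *)
have finA : finite_set A.
  apply: contrapT => /limit_points; apply=> y.
  have [[w [Aw yw wy]]|none] := pselect (exists w,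
      [/\ A w, d y w < e / 2 & w <> y]).
    exists (d y w); first by apply/distance_gt0/nesym.
    move=> z Az yz; apply: contrapT => zy.
    suff zw : z = w by move: yz; rewrite zw ltxx.
    apply: sepA => //; have := dist_triangle d y z w.
    by rewrite (dist_sym d z y); lra.
  exists (e / 2) => [|z Az yz]; first lra.
  by apply: contrapT => zy; apply: none; exists z.
exists A => // y; apply: contrapT => far.
have {}far z : A z -> ~ d z y < e by move=> Az zy; apply: far; exists z.
have Ay : ~ A y by move/far; rewrite dist_xx.
apply: (maxA (A `|` [set y])).
  by split; [exact: subsetUl|move=> /(_ y); apply: contra_not Ay; apply; right].
move=> z w [Az|->] [Aw|->] //.
- exact: sepA.
- by move=> /(far z Az).
- by rewrite dist_sym => /(far w Aw).
Qed.

Lemma limit_points_compact (tau : topology X) :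
  compatible d tau -> compact [set: topspace tau].
Proof.
move=> d_tau; rewrite compact_ultra => F FU _.
have small e : 0 < e -> exists c, F [set z | d c z < e].
  move=> /finite_net[A finA netA].
  have [|c _ Fc] := @ultra_finite_bigcup _ (mspace d) F A
    (fun c => [set z | d c z < e]) FU finA.
    by apply: filterS filterT => y _; have [c Ac cy] := netA y; exists c.
  by exists c.
have /choice[c Fc] : forall n : nat, exists c, F [set z | d c z < n.+1%:R^-1].
  by move=> n; apply: small; rewrite invr_gt0 ltr0n.
have [y cy] := sequence_cluster c.
exists (y : topspace tau); split=> // V /(nbhs_topspaceP d_tau)[r r0 rV].
have r20 : 0 < r / 2 by lra.
have [N _ NR] := near_infty_natSinv_lt (PosNum r20).
have [n Nn ycn] := cy _ N r20.
have nr : n.+1%:R^-1 < r / 2 := NR n Nn.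
apply: filterS (Fc n) => z cz; apply: rV.
apply: le_lt_trans (dist_triangle d (c n) y z) _.
by rewrite (splitr r) ltrD// (lt_trans cz).
Qed.

End LimitPointCompact.

Lemma noncompact_no_accumulation {R : realType} {X : Type} {d : metric R X}
    {tau : topology X} :
  compatible d tau -> ~ compact [set: topspace tau] ->
  exists2 S : set X, infinite_set S & no_accumulation d S.
Proof.
move=> d_tau; apply: contra_notP => noS; apply: limit_points_compact d_tau.
by move=> S infS nS; apply: noS; exists S.
Qed.

Theorem theorem1p1 (R : realType) (X : Type) (tau : topology X) (a : X)
    (d : metric R X)
    (tau_metrizable : metrizable R tau)
    (tau_noncompact : ~ compact [set: topspace tau])
    (d_compatible : compatible d tau) :
  (exists (D : set X) (x : nat -> X),
    [/\ set_bij [set: nat] D x, closed_discrete tau D, D `<=` ~` [set a] &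
      forall lambda : nat -> R,
        (forall n, 0 < lambda n) -> lambda @ \oo --> (0 : R) ->
        exists p : metric R X, collapsing_metric tau a d x lambda p]) /\
  (forall (D : set X) (x : nat -> X),
    set_bij [set: nat] D x -> closed_discrete tau D -> D `<=` ~` [set a] ->
    forall lambda : nat -> R,
      (forall n, 0 < lambda n) -> lambda @ \oo --> (0 : R) ->
      exists p : metric R X, collapsing_metric tau a d x lambda p).
Proof.
have collapsing D x : set_bij [set: nat] D x -> closed_discrete tau D ->
    D `<=` ~` [set a] -> forall lambda : nat -> R,
      (forall n, 0 < lambda n) -> lambda @ \oo --> (0 : R) ->
      exists p : metric R X, collapsing_metric tau a d x lambda p.
  move=> [xD x_inj Dx] /(closed_discreteP d_compatible) nD Da lambda l0 l_cvg.
  apply: collapsing_metric_no_accumulation => //.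
  - by move=> m n; apply: x_inj; exact: in_setT.
  - by apply: no_accumulationS nD => _ [n _ <-]; exact: xD.
  - by move=> n; apply: Da; exact: xD.
split=> //.
have [S infS nS] := noncompact_no_accumulation d_compatible tau_noncompact.
(* [D] is a countably infinite part of what remains of [S] without [a]. *)
have /infiniteP/card_leP[y] : infinite_set (S `\ a).
  exact/infinite_setD/finite_set1.
pose x n : X := set_val (y (to_setT n)).
have xbij : set_bij [set: nat] (range x) x.
  split=> [n _||//]; first by exists n.
  move=> m n _ _ /val_inj /inj eq_mn.
  by have /(congr1 val) := eq_mn (in_setT _) (in_setT _).
have xS : range x `<=` S `\ a by move=> _ [n _ <-]; exact/set_mem/valP.
have cD : closed_discrete tau (range x).
  apply/(closed_discreteP d_compatible); apply: no_accumulationS nS.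
  by move=> z /xS[].
have xa : range x `<=` ~` [set a] by move=> z /xS[].
exists (range x), x; split=> // lambda l0 l_cvg.
exact: (collapsing (range x)).
Qed.
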